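(* Let $(R_1,B_1)$ and $(R_2,B_2)$ be two SP-games. If their legal complexes $\Delta_{R_1,B_1}$ and $\Delta_{R_2,B_2}$ are isomorphic (as simplicial complexes whose vertices are bipartitioned into Left and Right basic positions, the isomorphism respecting the bipartitions), then the game trees of $(R_1,B_1)$ and $(R_2,B_2)$ are isomorphic, i.e. the two games are literally equal.
   Context: A board is a finite graph. A ruleset $R$ specifies which pieces each of the two players, Left and Right, may place (each piece occupies a non-empty collection of vertices of the board) and which placements are legal; $(R,B)$ denotes the game with ruleset $R$ played on board $B$. A position is a configuration of pieces on the board. A basic position is the board with exactly one piece placed (a Left or Right basic position according to who owns the piece). A position is legal if it can be reached from the empty board by a sequence of legal moves, and illegal otherwise. A strong placement game (SP-game) is a combinatorial game (two players, perfect information, no chance, no simultaneous moves) such that: (i) the board is empty at the beginning; (ii) players place pieces on empty spaces of the board according to the rules; (iii) pieces are not moved or removed once placed; (iv) if a position can be reached through a sequence of legal moves, then any sequence of moves leading to this position consists of legal moves. Hence a position is identified with the set of basic positions it is made of, and every subset of a legal position is legal. The legal complex $\Delta_{R,B}$ of an SP-game is the simplicial complex whose vertex set is the set of all basic positions, whose faces are the legal positions (so its facets are the maximal legal positions), and whose vertex set is bipartitioned into the set of Left basic positions and the set of Right basic positions. The game tree of a game is the rooted directed tree with edges labelled $L$ or $R$: the root is the empty board, the vertices correspond to positions (reached by moves of either player, in any order of players), and there is an edge $X\stackrel{L}{\rightarrow}Y$ (respectively $X\stackrel{R}{\rightarrow}Y$) for each legal move of Left (respectively Right) from $X$ to $Y$.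 Isomorphisms of game trees preserve the root and edge labels. Two games with isomorphic game trees are called literally equal. *)

(* Defs.v *)
From HB Require Import structures.
From mathcomp Require Import all_boot finmap.

Set Implicit Arguments.
Unset Strict Implicit.
Unset Printing Implicit Defensive.

Local Open Scope fset_scope.

Inductive player := Left | Right.

Record board := Board {
  space :> finType;
  adjacent : rel space;
  adjacent_sym : symmetric adjacent;
  adjacent_irrefl : irreflexive adjacent }.

(* For each board [B], an element of [basic R B] is a piece together with the
   place it takes on [B]; the position consisting of that single piece is thus
   a basic position. There may be infinitely many kinds of pieces, and basic
   positions are allowed to be illegal. Legality of a move depends only on the
   pieces already on the board; a ruleset says nothing about whose turn it
   is, and [owner b] is the only player who can place [b]. *)
Record ruleset := Ruleset {
  basic : board -> choiceType;
  owner : forall B : board, basic B -> player;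
  cells : forall B : board, basic B -> {set B};
  cells_neq0 : forall (B : board) (b : basic B), cells b != set0;
  legal_move : forall B : board, {fset basic B} -> basic B -> bool }.

Section Positions.
Variables (R : ruleset) (B : board).

Definition position := {fset basic R B}.

Definition position_of (s : seq (basic R B)) : position := [fset b in s].

Fixpoint legal_from (X : position) (s : seq (basic R B)) : bool :=
  if s is b :: s' then legal_move X b && legal_from (b |` X) s' else true.

Definition legal_play (s : seq (basic R B)) : bool := legal_from fset0 s.

Definition legal_position (X : position) : Prop :=
  exists2 s, legal_play s & position_of s = X.

(* Play starts from the empty board and a move only ever adds a piece, by the
   definition of [legal_play]; the remaining requirements on a strong placement
   game are the two below. In the second one, a sequence of moves leading to
   [X] is an enumeration of the pieces of [X]. *)
Record sp_game : Prop := SPGame {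
  sp_empty_spaces : forall (X : position) (b : basic R B),
    legal_position X -> legal_move X b ->
    forall c, c \in X -> [disjoint cells b & cells c]%B;
  sp_any_order : forall X : position, legal_position X ->
    forall s, uniq s -> position_of s = X -> legal_play s }.

Lemma legal_from_cat X s t :
  legal_from X (s ++ t) = legal_from X s && legal_from (position_of s `|` X) t.
Proof.
elim: s X => [|b s IHs] X /=.
  by congr legal_from; apply/fsetP => c; rewrite !inE.
rewrite IHs andbA; congr (_ && legal_from _ _).
by apply/fsetP => c; rewrite !inE orbCA orbA.
Qed.

Lemma legal_play_cat s t :
  legal_play (s ++ t) = legal_play s && legal_from (position_of s) t.
Proof. by rewrite /legal_play legal_from_cat fsetU0. Qed.

Lemma legal_play_rcons s b :
  legal_play (rcons s b) = legal_play s && legal_move (position_of s) b.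
Proof. by rewrite -cats1 legal_play_cat /= andbT. Qed.

Lemma legal_position0 : legal_position fset0.
Proof. by exists [::] => //; apply/fsetP => b; rewrite !inE. Qed.

Lemma legal_position_sub (spRB : sp_game) (X Y : position) :
  Y `<=` X -> legal_position X -> legal_position Y.
Proof.
move=> sYX legX; pose s := enum_fset Y ++ enum_fset (X `\` Y).
have sX : position_of s = X.
  apply/fsetP => b; rewrite !inE.
  by case: (boolP (b \in Y)) => // /(fsubsetP sYX) ->.
have us : uniq s.
  rewrite cat_uniq !fset_uniq andbT /=; apply/hasPn => b.
  by rewrite in_fsetD => /andP[].
have := sp_any_order spRB legX us sX.
rewrite legal_play_cat => /andP[legY _]; exists (enum_fset Y) => //.
by apply/fsetP => b; rewrite !inE.
Qed.

End Positions.

(* A simplicial complex with a bipartitioned vertex set. As is common for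
   complexes on a prescribed vertex set, a vertex need not be a face. *)
Record bicomplex := Bicomplex {
  vertex : choiceType;
  face : {fset vertex} -> Prop;
  side : vertex -> player;
  face0 : face fset0;
  face_sub : forall X Y : {fset vertex}, Y `<=` X -> face X -> face Y }.

Definition bicomplex_iso (D1 D2 : bicomplex) : Prop :=
  exists f : vertex D1 -> vertex D2,
    [/\ bijective f,
        forall X : {fset vertex D1}, face X <-> face [fset f x | x in X]
      & forall x, side (f x) = side x].

Definition legal_complex (R : ruleset) (B : board) (spRB : sp_game R B) :
    bicomplex :=
  {| vertex := basic R B;
     face := @legal_position R B;
     side := @owner R B;
     face0 := legal_position0 R B;
     face_sub := @legal_position_sub R B spRB |}.

Record labelled_tree := LabelledTree {
  node : Type;
  root : node;
  edge : player -> node -> node -> Prop;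
  root_no_parent : forall p x, ~ edge p x root;
  parent_unique : forall p q x y z, edge p x z -> edge q y z -> p = q /\ x = y;
  root_reaches : forall P : node -> Prop,
    P root -> (forall p x y, P x -> edge p x y -> P y) -> forall x, P x }.

Definition tree_iso (T1 T2 : labelled_tree) : Prop :=
  exists f : node T1 -> node T2,
    [/\ bijective f,
        f (root T1) = root T2
      & forall p x y, edge p x y <-> edge p (f x) (f y)].

Section GameTree.
Variables (R : ruleset) (B : board).

(* Since the game tree is a tree, a position reachable by several sequences of
   moves occurs once for each of them: the node [s] is the occurrence of
   [position_of s] reached by the moves [s]. *)
Definition play := {s : seq (basic R B) | legal_play s}.

Definition empty_play : play := exist (fun s => legal_play s) [::] isT.

Definition play_edge (p : player) (s t : play) : Prop :=
  exists b : basic R B,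
    [/\ owner b = p,
        legal_move (position_of (val s)) b
      & val t = rcons (val s) b].

Lemma play_edge_root p s : ~ play_edge p s empty_play.
Proof. by case=> b [_ _]; case: (val s). Qed.

Lemma play_edge_parent p q s t u :
  play_edge p s u -> play_edge q t u -> p = q /\ s = t.
Proof.
move=> [b [<- _ us]] [c [<- _]]; rewrite us => /rcons_inj[/val_inj-> ->].
by split.
Qed.

Lemma play_edge_ind (P : play -> Prop) :
  P empty_play -> (forall p s t, P s -> play_edge p s t -> P t) ->
  forall s, P s.
Proof.
move=> P0 PS [s]; elim/last_ind: s => [|s b IHs] leg_s.
  by rewrite (_ : exist _ _ _ = empty_play) //; apply: val_inj.
have := leg_s; rewrite legal_play_rcons => /andP[leg_s' leg_b].
by apply: (PS (owner b)) (IHs leg_s') _; exists b.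
Qed.

Definition game_tree : labelled_tree :=
  {| node := play;
     root := empty_play;
     edge := play_edge;
     root_no_parent := play_edge_root;
     parent_unique := play_edge_parent;
     root_reaches := play_edge_ind |}.

End GameTree.

Definition literally_equal (R1 : ruleset) (B1 : board)
    (R2 : ruleset) (B2 : board) : Prop :=
  tree_iso (game_tree R1 B1) (game_tree R2 B2).

(* Main.v *)
(* In a strong placement game a sequence of moves is legal exactly when it has
   no repetition (a piece cannot be placed on its own, non-empty, cells) and its
   pieces form a legal position. The complex therefore determines which
   sequences of basic positions are legal plays, and these are the nodes of the
   game tree; an isomorphism of complexes acts on them entrywise. *)
From mathcomp Require Import all_boot finmap.
Require Import Defs.

Set Implicit Arguments.
Unset Strict Implicit.
Unset Printing Implicit Defensive.

Local Open Scope fset_scope.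

Section LegalPlays.
Variables (R : ruleset) (B : board).
Implicit Types s : seq (basic R B).

Lemma legal_play_uniq (spRB : sp_game R B) s : legal_play s -> uniq s.
Proof.
elim/last_ind: s => // s b IHs; rewrite legal_play_rcons => /andP[leg_s leg_b].
rewrite rcons_uniq (IHs leg_s) andbT; apply/negP => s_b.
have leg_pos : legal_position (position_of s) by exists s.
(* Taking for [c] the repeated piece [b] itself makes [cells b] disjoint from itself, hence
   empty. *)
have := sp_empty_spaces spRB leg_pos leg_b (c := b).
rewrite inE => /(_ s_b); rewrite -setI_eq0 setIid.
exact/negP/cells_neq0.
Qed.

Lemma legal_playP (spRB : sp_game R B) s :
  legal_play s <-> uniq s /\ legal_position (position_of s).
Proof.
split=> [leg_s | [us leg_pos]]; last exact: (sp_any_order spRB leg_pos us).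
by split; [exact: legal_play_uniq leg_s | exists s].
Qed.

(** Legality of the move is already contained in that of the play [t], so only the owner and the
    added piece have to be transported along an isomorphism. *)
Lemma play_edgeE (p : player) (s t : play R B) :
  play_edge p s t <-> exists2 b, owner b = p & val t = rcons (val s) b.
Proof.
split=> [[b [ob _ ts]] | [b ob ts]]; exists b => //; split=> //.
by have := valP t; rewrite /= ts legal_play_rcons => /andP[].
Qed.

End LegalPlays.

Lemma position_of_map (R1 R2 : ruleset) (B1 B2 : board)
    (f : basic R1 B1 -> basic R2 B2) (s : seq (basic R1 B1)) :
  position_of (map f s) = [fset f x | x in position_of s].
Proof.
apply/fsetP => y; rewrite inE; apply/mapP/imfsetP => /= -[x s_x ->].
  by exists x; rewrite ?inE.
by exists x; rewrite inE in s_x.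
Qed.

(** Of the two conditions in [legal_playP], the absence of repetition is carried by injectivity and
    the legality of the set of pieces by the hypothesis on positions. *)
Lemma legal_play_map (R1 R2 : ruleset) (B1 B2 : board)
    (sp1 : sp_game R1 B1) (sp2 : sp_game R2 B2)
    (f : basic R1 B1 -> basic R2 B2) (s : seq (basic R1 B1)) :
  injective f ->
  (forall X : position R1 B1,
     legal_position X <-> legal_position [fset f x | x in X]) ->
  legal_play (map f s) = legal_play s.
Proof.
move=> f_inj f_legal; apply/idP/idP.
  move=> /(legal_playP sp2)[]; rewrite (map_inj_uniq f_inj) position_of_map.
  by move=> us /f_legal leg_s; apply/(legal_playP sp1).
move=> /(legal_playP sp1)[us /f_legal leg_s]; apply/(legal_playP sp2).
by rewrite (map_inj_uniq f_inj) position_of_map.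
Qed.

Theorem proposition1p15 (R1 : ruleset) (B1 : board) (R2 : ruleset) (B2 : board)
    (sp1 : sp_game R1 B1) (sp2 : sp_game R2 B2) :
  bicomplex_iso (legal_complex sp1) (legal_complex sp2) ->
  literally_equal R1 B1 R2 B2.
Proof.
move=> [f [f_bij f_face f_side]]; have f_inj := bij_inj f_bij.
have [g fK gK] := f_bij.
have legE s : legal_play (map f s) = legal_play s.
  exact (legal_play_map sp1 sp2 s f_inj f_face).
have leg_f (s : play R1 B1) : legal_play (map f (val s)).
  by rewrite legE; apply: valP.
(* Here [legE] is read backwards: applying [f] to [map g (val s)] gives back the legal play [s]. *)
have leg_g (s : play R2 B2) : legal_play (map g (val s)).
  by rewrite -legE (mapK gK); apply: valP.
pose F (s : play R1 B1) : play R2 B2 := exist (@legal_play R2 B2) _ (leg_f s).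
pose G (s : play R2 B2) : play R1 B1 := exist (@legal_play R1 B1) _ (leg_g s).
exists F; split.
- by exists G => s; apply: val_inj; rewrite /= ?(mapK fK) ?(mapK gK).
- exact: val_inj.
move=> p s t; split=> /play_edgeE[b ob ts]; apply/play_edgeE.
  by exists (f b); rewrite ?[LHS]f_side //= ts map_rcons.
(* Now [b] belongs to the second game; its preimage [g b] leads from [s] to [t], since [map f] can
   be cancelled. *)
exists (g b); first by rewrite -ob -[in RHS](gK b) [RHS]f_side.
by apply: (inj_map f_inj); rewrite map_rcons gK.
Qed.
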